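(* Let $a,b\ge 2$ be integers, let $n$ be an integer, and let $r=a$, $s=b$ if $n$ is even and $r=b$, $s=a$ if $n$ is odd. Abbreviate $f_m=f_{(a,b,m)}$, $t_m=t_{(a,b,m)}$, $I_m=I_{(a,b,m)}$. (1) If $r$ is even and $n\ge 7$, then $f_n = \left( f_{n-2}^{s} I_{n-2} t_{n-2}^{s-1}\right)^{r/2} f_{n-2}$. (2) If $r$ and $s$ are both odd and $n\ge 8$, then with $X = f_{n-3}^{r} I_{n-3} t_{n-3}^{r-1}$, $$f_n = \left[ X^{(s+1)/2}\, t_{n-3}\, X^{(s-1)/2}\, f_{n-3}\right]^{(r-1)/2} X^{(s+1)/2}\, t_{n-3}.$$ (3) If $r$ is odd, $s$ is even and $n\ge 9$, then with $Y = f_{n-4}^{s} I_{n-4} t_{n-4}^{s-1}$, $B = Y^{(r+1)/2} t_{n-4} Y^{(r-1)/2} f_{n-4}$, $C = Y^{(r+1)/2} f_{n-4}$ and $D = Y^{(r+1)/2} t_{n-4}$, $$f_n = \left\{ B^{s/2}\, C\, B^{(s-2)/2}\, D\right\}^{(r-1)/2} B^{s/2}\, C.$$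
   Context: Words are over the alphabet $\{0,1\}$, with concatenation as the product; $w^k$ denotes the concatenation of $k$ copies of $w$ ($w^0$ is the empty word). For integers $a,b\ge 1$ the biperiodic Fibonacci words are defined by $f_{(a,b,0)}=0$, $f_{(a,b,1)}=0^{a-1}1$, and for $n\ge 2$: $f_{(a,b,n)} = f_{(a,b,n-1)}^{a}f_{(a,b,n-2)}$ if $n$ is even, and $f_{(a,b,n)} = f_{(a,b,n-1)}^{b}f_{(a,b,n-2)}$ if $n$ is odd. For a word $f_{(a,b,n)}$ with at least two letters, write $f_{(a,b,n)} = p\,xy$ with $x,y$ letters; then $t_{(a,b,n)} := p\,yx$. For $m\ge 5$ let $r_m = a$ if $m$ is even and $r_m=b$ if $m$ is odd. With $a,b\ge 2$, $f_{(a,b,m)}$ has suffix $w_m := f_{(a,b,m-1)}^{r_m-2}f_{(a,b,m-2)}$ and $t_{(a,b,m)}$ has prefix $w_m$. The word $I_{(a,b,m)}$ is defined as the word which begins with $f_{(a,b,m)}$ and ends with $t_{(a,b,m)}$, where these two occurrences overlap in exactly $w_m$; i.e. $I_{(a,b,m)} = u\,w_m\,v$ where $f_{(a,b,m)}=u\,w_m$ and $t_{(a,b,m)} = w_m\,v$. (Thus $f_{(a,b,n)}$ is expressed as a concatenation of words $f$, $t$ and overlapping concatenations $I$ of level $n-2$, $n-3$ or $n-4$.) *)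

(* Defs.v *)
From mathcomp Require Import all_boot.

Set Implicit Arguments.
Unset Strict Implicit.
Unset Printing Implicit Defensive.

(* Binary words are [seq bool], with the letter 0 read as [false] and the
   letter 1 as [true]. *)

Definition word := seq bool.

Definition wpow (w : word) (k : nat) : word := flatten (nseq k w).

Definition bexp (a b n : nat) : nat := if odd n then b else a.

Fixpoint bfib (a b n : nat) : word :=
  match n with
  | 0 => [:: false]
  | 1 => rcons (nseq a.-1 false) true
  | (n''.+1 as n').+1 => wpow (bfib a b n') (bexp a b n) ++ bfib a b n''
  end.

(* Exchange of the last two letters; words with fewer than two letters, for
   which the exchange is meaningless, are left unchanged. *)
Definition swap_last2 (w : word) : word :=
  take (size w - 2) w ++ rev (drop (size w - 2) w).

Lemma swap_last2E (p : word) (x y : bool) :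
  swap_last2 (p ++ [:: x; y]) = p ++ [:: y; x].
Proof. by rewrite /swap_last2 size_cat addnK take_size_cat // drop_size_cat. Qed.

Definition bfib_t (a b n : nat) : word := swap_last2 (bfib a b n).

Definition bfib_w (a b m : nat) : word :=
  wpow (bfib a b m.-1) (bexp a b m - 2) ++ bfib a b m.-2.

(* [u ++ t] where [u] is [f] deprived of its last [size w] letters; [bfib_IP]
   below shows that the two factors do overlap in [w]. *)
Definition bfib_I (a b m : nat) : word :=
  let f := bfib a b m in
  take (size f - size (bfib_w a b m)) f ++ bfib_t a b m.

Lemma bfib_IP (a b m : nat) (ha : 2 <= a) (hb : 2 <= b) (hm : 5 <= m) :
  exists u v : word,
    [/\ bfib a b m = u ++ bfib_w a b m,
        bfib_t a b m = bfib_w a b m ++ v &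
        bfib_I a b m = u ++ bfib_w a b m ++ v].
Proof.
have wpowD w i j : wpow w (i + j) = wpow w i ++ wpow w j.
  by rewrite /wpow nseqD flatten_cat.
have wpow1 w : wpow w 1 = w by rewrite /wpow /= cats0.
have wpow2 w : wpow w 2 = w ++ w by rewrite /wpow /= cats0.
have e2 k : 2 <= bexp a b k by rewrite /bexp; case: odd.
have bfibSS k :
    bfib a b k.+2 = wpow (bfib a b k.+1) (bexp a b k.+2) ++ bfib a b k by [].
case: m hm => [|[|[|m]]] // _; set w := bfib_w a b m.+3.
have wE : w = wpow (bfib a b m.+2) (bexp a b m.+3 - 2) ++ bfib a b m.+1 by [].
have fE : bfib a b m.+3 = wpow (bfib a b m.+2) 2 ++ w.
  by rewrite bfibSS wE catA -wpowD subnKC.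
have [z zE] : exists z, bfib a b m.+2 = bfib a b m.+1 ++ z.
  exists (wpow (bfib a b m.+1) (bexp a b m.+2 - 1) ++ bfib a b m).
  by rewrite bfibSS -[in LHS](subnKC (ltnW (e2 m.+2))) wpowD wpow1 -catA.
have [q qE] : exists q, bfib a b m.+3 = w ++ q.
  exists (z ++ bfib a b m.+2 ++ bfib a b m.+1).
  rewrite bfibSS -[in LHS](subnK (e2 m.+3)) wpowD wpow2 wE.
  move: zE; move: (bfib a b m.+2) (bfib a b m.+1) => x y xE.
  by rewrite -!catA; congr (_ ++ _); rewrite {1}xE -!catA.
have f_gt0 k : 0 < size (bfib a b k.+1).
  case: k => [|k]; first by rewrite /= size_rcons.
  elim/ltn_ind: k => [[|[|k]]] IH.
  - by rewrite bfibSS size_cat addn_gt0 orbT.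
  - by rewrite bfibSS size_cat addn_gt0 /= size_rcons orbT.
  - by rewrite bfibSS size_cat addn_gt0 (IH k) ?orbT.
have q2 : 2 <= size q.
  have : size (bfib a b m.+3) = size (w ++ q) by rewrite qE.
  rewrite fE wpow2 size_cat size_cat (size_cat w q) addnC => /addnI <-.
  by rewrite -[2]/(1 + 1) leq_add.
have tE : bfib_t a b m.+3 = w ++ swap_last2 q.
  rewrite /bfib_t /swap_last2 qE size_cat -addnBA // take_cat drop_cat.
  by rewrite ltnNge leq_addr /= addKn catA.
exists (wpow (bfib a b m.+2) 2), (swap_last2 q); split=> //.
by rewrite /bfib_I tE fE size_cat addnK take_size_cat.
Qed.

(* Main.v *)
Require Import Defs.
From mathcomp Require Import all_boot.

(** Consecutive words almost commute: [f_m f_(m-1)] and [f_(m-1) f_m] differ only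
    by the exchange of their last two letters, so [f_m f_(m-1) = f_(m-1) t_m] and
    [f_(m-1) f_m = f_m t_(m-1)].  Hence [f_m] is conjugate to [t_m], which
    gives [f_m^s I_m t_m^(s-1) = f_(m+1)^2]: the words [X] and [Y] are squares
    of Fibonacci words, and the same exchange turns [B] into a square as well.
    The three formulas regroup [f_n = f_(n-1)^r f_(n-2)] into such squares. *)

Lemma wpowD w i j : wpow w (i + j) = wpow w i ++ wpow w j.
Proof. by rewrite /wpow nseqD flatten_cat. Qed.

Lemma wpow1 w : wpow w 1 = w.
Proof. by rewrite /wpow /= cats0. Qed.

Lemma wpowS w i : wpow w i.+1 = w ++ wpow w i.
Proof. by []. Qed.

Lemma wpowSr w i : wpow w i.+1 = wpow w i ++ w.
Proof. by rewrite -addn1 wpowD wpow1. Qed.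

Lemma wpowM w i j : wpow w (i * j) = wpow (wpow w i) j.
Proof. by elim: j => [|j IH]; rewrite ?muln0 // mulnS wpowD IH. Qed.

Lemma wpow_conj x y z k : x ++ y = y ++ z -> wpow x k ++ y = y ++ wpow z k.
Proof.
move=> xy; elim: k => [|k IH]; first by rewrite cats0.
by rewrite !wpowS -catA IH catA xy -catA.
Qed.

Lemma wpow_even w k : ~~ odd k -> wpow (wpow w 2) (k %/ 2) = wpow w k.
Proof. by move=> ek; rewrite -wpowM mulnC divnK // dvdn2. Qed.

Lemma wpow_odd w k : odd k -> wpow (wpow w 2) ((k - 1) %/ 2) ++ w = wpow w k.
Proof.
move=> ok; rewrite wpow_even ?oddB ?odd_gt0 ?ok //.
by rewrite -wpowSr subn1 prednK ?odd_gt0.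
Qed.

Lemma swap_last2_cat p q : 2 <= size q -> swap_last2 (p ++ q) = p ++ swap_last2 q.
Proof.
move=> q2; rewrite /swap_last2 size_cat -addnBA // take_cat drop_cat.
by rewrite ltnNge leq_addr /= addKn catA.
Qed.

Lemma swap_last2K : involutive swap_last2.
Proof.
move=> w; have [w2|w2] := leqP 2 (size w); last first.
  (* Truncated subtraction gives [0], so the whole word is reversed, harmless for at most one
     letter. *)
  rewrite /swap_last2; have /eqP-> : size w - 2 == 0 by rewrite subn_eq0 ltnW.
  by rewrite !take0 !drop0 /= size_rev; case: w w2 => [|x [|]].
have : size (drop (size w - 2) w) = 2 by rewrite size_drop subKn.
move: (cat_take_drop (size w - 2) w); move: (take _ _) => p.
by case: drop => [|x [|y []]] // <- _; rewrite !swap_last2E.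
Qed.

(** The left side is [x^s (x z) x^(s-1) y]. Replacing [x z] by [y x] releases an [x] that completes
    [x^(s-1)] to [x^s]. This handles the bracket of formula (2) and the word [B] of formula (3). *)
Lemma wpow_square_block x y z s : odd s -> x ++ z = y ++ x ->
  wpow (wpow x 2) ((s + 1) %/ 2) ++ z ++ wpow (wpow x 2) ((s - 1) %/ 2) ++ y
  = wpow (wpow x s ++ y) 2.
Proof.
move=> os xz; rewrite wpow_even ?oddD ?os // addn1 wpowSr -catA (catA x) xz -catA.
rewrite wpow_even ?oddB ?odd_gt0 ?os // (catA x) -wpowS subn1 prednK ?odd_gt0 //.
by rewrite wpowSr wpow1 !catA.
Qed.

Lemma wpow_square_tail x y z s : odd s -> x ++ z = y ++ x ->
  wpow (wpow x 2) ((s + 1) %/ 2) ++ z = wpow x s ++ y ++ x.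
Proof.
by move=> os xz; rewrite wpow_even ?oddD ?os // addn1 wpowSr -catA xz.
Qed.

Section BiperiodicFibonacci.

Variables a b : nat.
Hypotheses (ha : 2 <= a) (hb : 2 <= b).

Local Notation f := (bfib a b).
Local Notation t := (bfib_t a b).
Local Notation e := (bexp a b).

Lemma bexp_ge2 m : 2 <= e m.
Proof. by rewrite /bexp; case: odd. Qed.

Lemma bfibSS m : f m.+2 = wpow (f m.+1) (e m.+2) ++ f m.
Proof. by []. Qed.

Lemma size_bfib_ge2 m : 2 <= size (f m.+1).
Proof.
elim: m => [|m IH].
  by rewrite /= size_rcons size_nseq prednK // ltnW.
rewrite bfibSS -(subnK (ltnW (bexp_ge2 m.+2))) wpowD wpow1 -catA catA !size_cat.
by apply: leq_trans IH _; rewrite -addnA addnCA leq_addr.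
Qed.

Lemma bfib_near_comm m : f m.+1 ++ f m = f m ++ t m.+1.
Proof.
suff -> : f m.+1 ++ f m = swap_last2 (f m ++ f m.+1).
  by rewrite swap_last2_cat ?size_bfib_ge2.
elim: m => [|m IH].
  have -> : f 0 ++ f 1 = nseq a.-1 false ++ [:: false; true].
    by rewrite -[RHS]cat_rcons -cats1 -(nseqD _ 1) addn1 /= -cats1.
  by rewrite swap_last2E cat_rcons.
(* Both sides begin with the same power of [f m.+1]; past it remain [f m ++ f m.+1] and the exchange
   of [f m.+1 ++ f m], the induction hypothesis with its sides reversed. *)
rewrite bfibSS catA -wpowS wpowSr -!catA swap_last2_cat; last first.
  by rewrite size_cat (leq_trans (size_bfib_ge2 m)) ?leq_addr.
by rewrite IH swap_last2K.
Qed.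

Lemma bfib_near_comm_t m : f m.+2 ++ t m.+1 = f m.+1 ++ f m.+2.
Proof.
rewrite -[RHS]swap_last2K swap_last2_cat ?size_bfib_ge2 // -/(bfib_t a b m.+2).
by rewrite -bfib_near_comm swap_last2_cat ?size_bfib_ge2.
Qed.

(** The overlap has two factors [f m.+1] fewer than [f m.+2], so these two are what precedes
    [t m.+2]. *)
Lemma bfib_IE m : bfib_I a b m.+2 = wpow (f m.+1) 2 ++ t m.+2.
Proof.
rewrite /bfib_I /bfib_w /=; congr (_ ++ _).
rewrite -/(bfib a b m.+1) -[X in wpow _ X](subnKC (bexp_ge2 m.+2)) wpowD -catA.
by rewrite size_cat addnK take_size_cat.
Qed.

(** The [t m.+2] ending [I] raises the last power to [e m.+3]. Between the two powers stands
    [f m.+1] twice; conjugation by the second turns the power of [t m.+2] into one of [f m.+2], and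
    each half becomes [f m.+3]. *)
Lemma bfib_square m :
  wpow (f m.+2) (e m.+3) ++ bfib_I a b m.+2 ++ wpow (t m.+2) (e m.+3 - 1)
  = wpow (f m.+3) 2.
Proof.
rewrite bfib_IE -catA -wpowS subn1 prednK ?(ltnW (bexp_ge2 _)) //.
rewrite !wpowS [wpow _ 0]/= !cats0 -catA.
by rewrite -(wpow_conj _ _ _ _ (bfib_near_comm m.+1)) (bfibSS m.+1) -!catA.
Qed.

End BiperiodicFibonacci.

Theorem mainTheorem8 (a b n : nat) (ha : 2 <= a) (hb : 2 <= b) :
  let r := if odd n then b else a in
  let s := if odd n then a else b in
  let f := bfib a b in
  let t := bfib_t a b in
  let I := bfib_I a b in
  [/\ ~~ odd r -> 7 <= n ->
        f n = wpow (wpow (f (n - 2)) s ++ I (n - 2) ++ wpow (t (n - 2)) (s - 1))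
                   (r %/ 2)
              ++ f (n - 2),
      odd r -> odd s -> 8 <= n ->
        let X := wpow (f (n - 3)) r ++ I (n - 3) ++ wpow (t (n - 3)) (r - 1) in
        f n = wpow (wpow X ((s + 1) %/ 2) ++ t (n - 3)
                    ++ wpow X ((s - 1) %/ 2) ++ f (n - 3))
                   ((r - 1) %/ 2)
              ++ wpow X ((s + 1) %/ 2) ++ t (n - 3)
    & odd r -> ~~ odd s -> 9 <= n ->
        let Y := wpow (f (n - 4)) s ++ I (n - 4) ++ wpow (t (n - 4)) (s - 1) in
        let B := wpow Y ((r + 1) %/ 2) ++ t (n - 4)
                 ++ wpow Y ((r - 1) %/ 2) ++ f (n - 4) in
        let C := wpow Y ((r + 1) %/ 2) ++ f (n - 4) in
        let D := wpow Y ((r + 1) %/ 2) ++ t (n - 4) in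
        f n = wpow (wpow B (s %/ 2) ++ C ++ wpow B ((s - 2) %/ 2) ++ D)
                   ((r - 1) %/ 2)
              ++ wpow B (s %/ 2) ++ C].
Proof.
move=> r s f t I.
have fE k : f k.+2 = wpow (f k.+1) (bexp a b k.+2) ++ f k by [].
split.
- case: n @r @s => [|[|[|[|m]]]] // r s er _.
  (* Here [n] is [m.+4], and [s] is the exponent of level [n - 1], of parity opposite to [n]. *)
  have sE : s = bexp a b m.+3 by rewrite /s /bexp /= !negbK; case: odd.
  by rewrite !subSS subn0 sE bfib_square // wpow_even.
- case: n @r @s => [|[|[|[|[|m]]]]] // r s or os _ X.
  have rE : r = bexp a b m.+3 by rewrite /r /bexp /= !negbK; case: odd.
  have fE4 : f m.+4 = wpow (f m.+3) s ++ f m.+2.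
    by rewrite fE; congr (wpow _ _ ++ _); rewrite /s /bexp /= !negbK; case: odd.
  have XE : X = wpow (f m.+3) 2 by rewrite /X !subSS subn0 rE bfib_square.
  have xz : f m.+3 ++ t m.+2 = f m.+2 ++ f m.+3 by apply: bfib_near_comm_t.
  (* The bracket is [f m.+4] squared and the tail is [f m.+4 ++ f m.+3], which supplies the last of
     the [r] factors. *)
  rewrite XE !subSS subn0 (wpow_square_block _ _ _ _ os xz).
  by rewrite (wpow_square_tail _ _ _ _ os xz) (catA (wpow _ s)) -fE4 catA wpow_odd.
- case: n @r @s => [|[|[|[|[|[|m]]]]]] // r s or es _ Y B C D.
  have rE : r = bexp a b m.+4 by rewrite /r /bexp /= !negbK.
  have sE : s = bexp a b m.+3 by rewrite /s /bexp /= !negbK; case: odd.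
  have sE' : s = bexp a b m.+4.+1 by rewrite /s /bexp /= !negbK; case: odd.
  have xz : f m.+3 ++ t m.+2 = f m.+2 ++ f m.+3 by apply: bfib_near_comm_t.
  have YE : Y = wpow (f m.+3) 2 by rewrite /Y !subSS subn0 sE bfib_square.
  have BE : B = wpow (f m.+4) 2.
    by rewrite /B YE !subSS subn0 (wpow_square_block _ _ _ _ or xz) rE -fE.
  have CE : C = f m.+3 ++ f m.+4.
    by rewrite /C YE !subSS subn0 wpow_even ?oddD ?or // addn1 wpowS -catA rE -fE.
  have DE : D = f m.+4 ++ f m.+3.
    by rewrite /D YE !subSS subn0 (wpow_square_tail _ _ _ _ or xz) catA rE -fE.
  have s2 : 2 <= s by rewrite sE bexp_ge2.
  have fE5 : f m.+4.+1 = wpow (f m.+4) s ++ f m.+3 by rewrite fE -sE'.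
  rewrite BE CE DE !wpow_even ?oddB ?(negbTE es) //.
  (* The [f m.+4] ending [C] and the one opening [D] raise the exponent [s - 2] between them to
     [s]. *)
  have -> : wpow (f m.+4) s ++ (f m.+3 ++ f m.+4)
      ++ wpow (f m.+4) (s - 2) ++ f m.+4 ++ f m.+3 = wpow (f m.+4.+1) 2.
    rewrite [RHS]wpowSr wpow1 fE5; move: (f m.+4) (f m.+3) => x y.
    rewrite -!catA; congr (_ ++ (_ ++ _)); rewrite !catA -wpowS -wpowSr.
    by rewrite -(subnK s2) addnK addn2.
  by rewrite (catA (wpow _ s)) -fE5 catA wpow_odd.
Qed.
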